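(* Let $q=p^k$ with $p$ an odd prime. Let $A,B,C\in\mathbb{F}_q$ with $C\neq 0$, $A+B+1\neq0$, $A^3+AB+1\neq 0$, $A^2-AB-A+B^2-B+1\neq 0$, $A^3-ABC+AB+C^2-C+1=0$, and such that the polynomial $$m_{A,B,C}(t)=(AB-C)t^3+(-A^2C+AB^2-BC-B)t^2+(A^2B-AC^2-AC-B^2)t-AB+C\in\mathbb{F}_q[t]$$ has no roots in $\mu_{q^2+q+1}$. Then $$f(x)=x^{q^2+q-1}+Ax^{q^2-q+1}+Bx^{q^2}+Cx$$ is a permutation polynomial of $\mathbb{F}_{q^3}$.
   Context: $\mu_{q^2+q+1}=\{x\in\mathbb{F}_{q^3}: x^{q^2+q+1}=1\}$. A polynomial $f\in\mathbb{F}_{q^3}[x]$ is a permutation polynomial of $\mathbb{F}_{q^3}$ if $c\mapsto f(c)$ is a bijection of $\mathbb{F}_{q^3}$. *)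

(* Defs.v *)
From HB Require Import structures.
From mathcomp Require Import all_boot all_order all_algebra.

Set Implicit Arguments.
Unset Strict Implicit.
Unset Printing Implicit Defensive.

Import GRing.Theory.
Local Open Scope ring_scope.

Definition mu (L : finFieldType) (n : nat) : {set L} :=
  [set x : L | x ^+ n == 1].

Definition permutation_poly (L : finFieldType) (f : {poly L}) : Prop :=
  bijective (fun c : L => f.[c]).

Definition m_poly (F : fieldType) (A B C : F) : {poly F} :=
  (A * B - C)%:P * 'X^3
  + (- A ^+ 2 * C + A * B ^+ 2 - B * C - B)%:P * 'X^2
  + (A ^+ 2 * B - A * C ^+ 2 - A * C - B ^+ 2)%:P * 'X
  + (- (A * B) + C)%:P.

(* The exponents use truncated subtraction on nat, which is exact as soon as
   q >= 1. *)
Definition f_poly (L : fieldType) (q : nat) (A B C : L) : {poly L} :=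
  'X^(q ^ 2 + q - 1) + A%:P * 'X^(q ^ 2 - q + 1) + B%:P * 'X^(q ^ 2)
  + C%:P * 'X.

(* Main.v *)
Require Import Defs.
From HB Require Import structures.
From mathcomp Require Import all_boot all_order all_algebra.
From mathcomp Require Import all_field.
From mathcomp Require Import ring.

Set Implicit Arguments.
Unset Strict Implicit.
Unset Printing Implicit Defensive.

Import GRing.Theory.
Local Open Scope ring_scope.

(* For xi != 0 put x = xi^-1, y = x^q, z = x^(q^2). Then f(xi) = a / (xyz)
   with a = x^2 + A y^2 + B x y + C y z, and a^q, a^(q^2) are the cyclic
   shifts b, c of a. The relation between A, B and C says that the conics a =
   b = c = 0 have three common points, so that (x : y : z) |-> (a : b : c) is
   a quadratic Cremona map. At each common point x / y is a root of m. The
   inverse map is quadratic as well: inv_conic (a, b, c) = x D, with D a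
   cyclically invariant cubic, up to a constant the product of the lines
   joining the common points. If D is not 0, then a determines x up to a
   factor in F_q, and f is homogeneous of degree 1 over F_q. If D = 0, then
   (a : b : c) is one of the base points of the inverse map, and a cyclic
   linear change of coordinates turns the inverse map into a map of the
   original shape, which gives a root of m again. *)

(** * Polynomial identities for the conics and the inverse map *)

Section Conics.

Variables (K : fieldType) (A B C : K).

Local Notation e := (C - A * B).

Definition conic (x y z : K) : K :=
  x ^+ 2 + A * y ^+ 2 + B * x * y + C * y * z.

Definition inv_conic (a b c : K) : K :=
  (a - A * b) ^+ 2 + (2 * A ^+ 2 + B * e) * a * c
  + (1 - e - A ^+ 3) * b * c + A * (e - 1) * c ^+ 2.

Definition triangle (x y z : K) : K :=
  (A ^+ 3 + 1 - e) * (x ^+ 3 + y ^+ 3 + z ^+ 3)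
  + (2 * B - B * e + 2 * A ^+ 2 * e + 2 * A ^+ 3 * B)
    * (x ^+ 2 * y + y ^+ 2 * z + z ^+ 2 * x)
  + (B ^+ 2 - A - A * e + A ^+ 2 * B * e + A ^+ 3 * B ^+ 2 - A ^+ 4)
    * (x * y ^+ 2 + y * z ^+ 2 + z * x ^+ 2)
  + (3 + B ^+ 3 - 2 * A * B + A * B * e + A ^+ 2 * B ^+ 2 * e + 3 * A ^+ 3
     - A ^+ 3 * e + A ^+ 3 * B ^+ 3 - 2 * A ^+ 4 * B) * (x * y * z).

(* Found by requiring that the cyclic substitution
   (frame a b c, frame b c a, frame c a b) map the base points of inv_conic to
   those of conic. *)
Definition frame (a b c : K) : K :=
  (A * e + A ^+ 2 - A ^+ 3 - e - A) * a
  + (1 + B * e - A + A * e + A ^+ 2) * b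
  + (1 - A - A * e + A ^+ 2) * c.

Lemma m_polyE t :
  (m_poly A B C).[t] =
    (A * B - C) * t ^+ 3 + (- A ^+ 2 * C + A * B ^+ 2 - B * C - B) * t ^+ 2
    + (A ^+ 2 * B - A * C ^+ 2 - A * C - B ^+ 2) * t + (- (A * B) + C).
Proof. by rewrite /m_poly !hornerE. Qed.

(** Eliminating z from the three equations, first its square and then its linear term, leaves a
    cubic form in x and y. *)
Lemma conic_base_point_root (x y z : K) :
  y != 0 -> conic x y z = 0 -> conic y z x = 0 -> conic z x y = 0 ->
  (m_poly A B C).[x / y] = 0.
Proof.
move=> y0 a0 b0 c0.
have -> : (m_poly A B C).[x / y] =
    (C * y * (conic y z x - A * conic z x y)
     - (e * x + B * y) * conic x y z) / y ^+ 3.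
  by rewrite m_polyE /conic; field.
by rewrite a0 b0 c0 !(mulr0, subr0, mul0r).
Qed.

Lemma inv_conic_homog l a b c :
  inv_conic (l * a) (l * b) (l * c) = l ^+ 2 * inv_conic a b c.
Proof. by rewrite /inv_conic; ring. Qed.

Lemma conic_homog l x y z :
  conic (l * x) (l * y) (l * z) = l ^+ 2 * conic x y z.
Proof. by rewrite /conic; ring. Qed.

Hypothesis rel : A ^+ 3 - A * B * C + A * B + C ^+ 2 - C + 1 = 0.

Lemma relA3 : A ^+ 3 = A * B * C - A * B - C ^+ 2 + C - 1.
Proof. by rewrite -[LHS]subr0 -rel; ring. Qed.

(** The relation becomes A^3 = -1, which kills every coefficient of m. *)
Lemma m_poly_eq0 t : e = 0 -> (m_poly A B C).[t] = 0.
Proof.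
move=> e0; have CE : C = A * B by apply/eqP; rewrite -subr_eq0 e0.
have A3 : A ^+ 3 = - 1 by rewrite relA3 CE; ring.
by rewrite m_polyE CE; ring: A3.
Qed.

Lemma inv_conicK x y z :
  inv_conic (conic x y z) (conic y z x) (conic z x y) =
  x * (e * triangle x y z).
Proof. by rewrite /inv_conic /conic /triangle; ring: relA3. Qed.

(** [frame] carries base points to base points, so the pulled-back conic lies in the net spanned by
    the cyclic shifts of [inv_conic]. *)
Lemma conic_frame a b c :
  conic (frame a b c) (frame b c a) (frame c a b) =
    (- 1 + 2 * e - B + 4 * A - 4 * A * e + 2 * A * B + A * B * e - 6 * A ^+ 2
     + 4 * A ^+ 2 * e - 3 * A ^+ 2 * B + 5 * A ^+ 3 - A ^+ 3 * e
     + 2 * A ^+ 3 * B - 2 * A ^+ 4 - A ^+ 4 * B) * inv_conic a b c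
  + (2 - e + B * e - 5 * A + 2 * A * e - A * B * e + 6 * A ^+ 2 - A ^+ 2 * e
     - 4 * A ^+ 3 + A ^+ 4) * inv_conic b c a
  + (2 - e + 2 * B + B ^+ 2 * e - A - 3 * A * B + 2 * A * B * e + A ^+ 2 * e
     + 3 * A ^+ 2 * B + 2 * A ^+ 3 - A ^+ 3 * B - A ^+ 4) * inv_conic c a b.
Proof. by rewrite /inv_conic /conic /frame; ring: relA3. Qed.

Lemma frame_ker a b c :
  frame a b c = 0 -> frame b c a = 0 -> frame c a b = 0 ->
  frame 1 1 1 ^+ 2 * (e * (1 + A + B + C)) * a = 0.
Proof.
rewrite /frame.
set r0 := (A * e + A ^+ 2 - A ^+ 3 - e - A).
set r1 := (1 + B * e - A + A * e + A ^+ 2).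
set r2 := (1 - A - A * e + A ^+ 2) => p0 p1 p2.
(* The right-hand side is the determinant of the circulant matrix of frame. *)
have -> : (r0 * 1 + r1 * 1 + r2 * 1) ^+ 2 * (e * (1 + A + B + C)) =
    r0 ^+ 3 + r1 ^+ 3 + r2 ^+ 3 - 3 * r0 * r1 * r2.
  by rewrite /r0 /r1 /r2; ring: relA3.
(* Cramer's rule: the multipliers are the cofactors of the first column. *)
have -> : (r0 ^+ 3 + r1 ^+ 3 + r2 ^+ 3 - 3 * r0 * r1 * r2) * a =
    (r0 ^+ 2 - r1 * r2) * (r0 * a + r1 * b + r2 * c)
    + (r2 ^+ 2 - r0 * r1) * (r0 * b + r1 * c + r2 * a)
    + (r1 ^+ 2 - r0 * r2) * (r0 * c + r1 * a + r2 * b) by ring.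
by rewrite p0 p1 p2 !mulr0 !addr0.
Qed.

(** Reduces [frame 1 1 1 != 0] to the nonvanishing of both factors on the left. *)
Lemma frame111_dvd :
  e * ((1 + C) ^+ 2 + A ^+ 2 + B ^+ 2 - (1 + C) * A - (1 + C) * B - A * B) =
  frame 1 1 1 * (C + B - 2 * A - 2).
Proof. by rewrite /frame; ring: relA3. Qed.

End Conics.

(** * Injectivity of f over a field with an automorphism [phi] whose cube is the identity *)

Section CubicAutomorphism.

Variables (L : fieldType) (phi : {rmorphism L -> L}) (A B C : L).

Hypotheses (phi3 : forall x, phi (phi (phi x)) = x)
  (phiA : phi A = A) (phiB : phi B = B) (phiC : phi C = C)
  (rel : A ^+ 3 - A * B * C + A * B + C ^+ 2 - C + 1 = 0)
  (m_norm1 : forall t, t * phi t * phi (phi t) = 1 -> (m_poly A B C).[t] != 0).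

Local Notation e := (C - A * B).
Local Notation conicL v := (conic A B C v (phi v) (phi (phi v))).
Local Notation norm v := (v * phi v * phi (phi v)).

Lemma phi_conic x y z :
  phi (conic A B C x y z) = conic A B C (phi x) (phi y) (phi z).
Proof. by rewrite /conic !(rmorphD, rmorphM, rmorphXn) phiA phiB phiC. Qed.

Lemma phi_frame a b c :
  phi (frame A B C a b c) = frame A B C (phi a) (phi b) (phi c).
Proof.
by rewrite /frame !(rmorphD, rmorphB, rmorphN, rmorphM, rmorphXn, rmorph1)
           phiA phiB phiC.
Qed.

Lemma phi_inv_conic a b c :
  phi (inv_conic A B C a b c) = inv_conic A B C (phi a) (phi b) (phi c).
Proof.
rewrite /inv_conic !(rmorphD, rmorphB, rmorphN, rmorphM, rmorphXn, rmorph1).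
by rewrite phiA phiB phiC.
Qed.

Lemma phi_triangle v :
  phi (triangle A B C v (phi v) (phi (phi v))) =
  triangle A B C v (phi v) (phi (phi v)).
Proof.
rewrite /triangle !(rmorphD, rmorphB, rmorphN, rmorphM, rmorphXn, rmorph1).
by rewrite ?rmorph_nat phiA phiB phiC phi3; ring.
Qed.

Lemma phi_norm v : phi (norm v) = norm v.
Proof. by rewrite !rmorphM phi3 mulrC mulrA. Qed.

Lemma norm_neq0 (v : L) : v != 0 -> norm v != 0.
Proof. by move=> v0; rewrite !mulf_neq0 ?fmorph_eq0. Qed.

Lemma e_neq0 : e != 0.
Proof.
apply/eqP=> e0; have := @m_norm1 1; rewrite !rmorph1 !mulr1.
by rewrite m_poly_eq0 ?eqxx // => /(_ erefl).
Qed.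

(** [phi] permutes the three conics cyclically, so a zero yields a common point, and with it the
    root v / phi v of m, of norm 1. *)
Lemma conicL_neq0 (v : L) : v != 0 -> conicL v != 0.
Proof.
move=> v0; have pv0 : phi v != 0 by rewrite fmorph_eq0.
have ppv0 : phi (phi v) != 0 by rewrite fmorph_eq0.
apply/eqP=> a0.
have b0 : conic A B C (phi v) (phi (phi v)) v = 0.
  by rewrite -[in X in conic _ _ _ _ _ X](phi3 v) -phi_conic a0 rmorph0.
have c0 : conic A B C (phi (phi v)) v (phi v) = 0.
  by rewrite -[in X in conic _ _ _ _ X _](phi3 v) -phi_conic b0 rmorph0.
have := @m_norm1 (v / phi v); rewrite (conic_base_point_root pv0 a0 b0 c0) eqxx.
rewrite !fmorph_div phi3 => h; suff: false by [].
by apply: h; field; rewrite v0 pv0 ppv0.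
Qed.

(** Otherwise (1 : t^2 : t) lies on all three conics and t, of norm t^3 = 1, is a root of m. *)
Lemma cube_root1_neq0 t :
  phi t = t -> t ^+ 3 = 1 -> 1 + C + A * t + B * t ^+ 2 != 0.
Proof.
move=> pt t3; apply/eqP=> h.
have t0 : t != 0.
  by apply: contra_eq_neq t3 => ->; rewrite expr0n eq_sym oner_eq0.
have := @m_norm1 t; rewrite !pt -expr2 -exprSr => /(_ t3).
have -> : t = 1 / t ^+ 2 by rewrite -t3; field.
rewrite (@conic_base_point_root _ _ _ _ _ _ t) ?eqxx ?expf_neq0 //.
- by rewrite -[RHS]h /conic; ring: t3.
- by rewrite -[RHS](mulr0 t) -h /conic; ring: t3.
- by rewrite -[RHS](mulr0 (t ^+ 2)) -h /conic; ring: t3.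
Qed.

Lemma frame111_neq0 : frame A B C 1 1 1 != 0.
Proof.
(* W is the product of 1 + C + A t + B t^2 over the primitive cube roots of
   unity t. If W = 0 and A != B, one of these roots is fixed by phi. *)
pose W := (1 + C) ^+ 2 + A ^+ 2 + B ^+ 2 - (1 + C) * A - (1 + C) * B - A * B.
suff W0 : W != 0.
  have := mulf_neq0 e_neq0 W0; rewrite /W frame111_dvd //.
  by rewrite mulf_eq0 negb_or => /andP[].
apply/eqP=> W0; have [AB|nAB] := eqVneq A B.
  (* Here W = (1 + C - A)^2. The relation then gives 3 e = 0, hence 1 + A + B + C = 3 A = 0, which
     is excluded at t = 1. *)
  have CE : C = A - 1.
    apply/eqP; rewrite -subr_eq0 -sqrf_eq0; apply/eqP; rewrite -[RHS]W0.
    by rewrite /W -AB; ring.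
  have three0 : 3 = 0 :> L.
    apply/eqP; rewrite -(mulIr_eq0 _ (mulIf e_neq0)); apply/eqP.
    by rewrite -[RHS]oppr0 -rel -AB CE; ring.
  have := @cube_root1_neq0 1; rewrite rmorph1 expr1n => /(_ erefl erefl).
  by apply/negP/negPn/eqP; rewrite -[RHS](mul0r A) -three0 -AB CE; ring.
have dAB : A - B != 0 by rewrite subr_eq0.
(* The solution of 1 + C + A t + B t^2 = 0 once t^2 is replaced by - t - 1; W = 0 justifies that
   replacement. *)
pose t := (B - (1 + C)) / (A - B).
have t2 : t ^+ 2 = - t - 1.
  apply/eqP; rewrite -subr_eq0; apply/eqP.
  rewrite -[RHS](mul0r ((A - B) ^- 2)) -W0 /W /t.
  by field.
have pt : phi t = t.
  by rewrite /t fmorph_div !rmorphB rmorphD rmorph1 phiA phiB phiC.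
have t3 : t ^+ 3 = 1 by rewrite exprS t2; ring: t2.
have := cube_root1_neq0 pt t3; rewrite t2.
by rewrite (_ : _ + _ = 0) ?eqxx // /t; field.
Qed.

Lemma triangle_neq0 (v : L) :
  v != 0 -> triangle A B C v (phi v) (phi (phi v)) != 0.
Proof.
move=> v0; apply/eqP=> D0.
pose a := conicL v.
have a0 : a != 0 := conicL_neq0 v0.
have pa : phi a = conic A B C (phi v) (phi (phi v)) v by rewrite phi_conic phi3.
have ppa : phi (phi a) = conic A B C (phi (phi v)) v (phi v).
  by rewrite pa phi_conic phi3.
have G1 : inv_conic A B C a (phi a) (phi (phi a)) = 0.
  by rewrite ppa pa inv_conicK // D0 !mulr0.
have G2 : inv_conic A B C (phi a) (phi (phi a)) a = 0.
  by rewrite -[in X in inv_conic _ _ _ _ _ X](phi3 a) -phi_inv_conic G1 rmorph0.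
have G3 : inv_conic A B C (phi (phi a)) a (phi a) = 0.
  by rewrite -[in X in inv_conic _ _ _ _ X _](phi3 a) -phi_inv_conic G2 rmorph0.
pose p := frame A B C a (phi a) (phi (phi a)).
have pp : phi p = frame A B C (phi a) (phi (phi a)) a by rewrite phi_frame phi3.
have ppp : phi (phi p) = frame A B C (phi (phi a)) a (phi a).
  by rewrite pp phi_frame phi3.
(* By [conic_frame] the conic vanishes at p and its conjugates, which forces p = 0; the circulant
   system then gives a = 0. *)
have p0 : p = 0.
  apply: contraTeq isT => /conicL_neq0.
  by rewrite ppp pp /p conic_frame // G1 G2 G3 !mulr0 !addr0 eqxx.
have V0 : 1 + A + B + C != 0.
  have := @cube_root1_neq0 1; rewrite rmorph1 expr1n => /(_ erefl erefl).
  by rewrite expr1n !mulr1 -!addrA (addrC C) -!addrA.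
have /eqP : frame A B C 1 1 1 ^+ 2 * (e * (1 + A + B + C)) * a = 0.
  by apply: (frame_ker rel p0); rewrite -?ppp -?pp p0 !rmorph0.
apply/negP; rewrite mulf_neq0 // mulf_neq0 ?(mulf_neq0 e_neq0) //.
by rewrite expf_neq0 ?frame111_neq0.
Qed.

(** f with x^q written as phi x; since 0^-1 = 0, its value at 0 is 0. *)
Definition f_fun (x : L) : L :=
  phi (phi x) * phi x / x + A * (phi (phi x) * x / phi x) + B * phi (phi x)
  + C * x.

Lemma f_fun_conic (v : L) : v != 0 -> conicL v = f_fun v^-1 * norm v.
Proof.
move=> v0; rewrite /f_fun /conic !fmorphV; field.
by rewrite !fmorph_eq0 v0 oner_eq0.
Qed.

Lemma f_funV_inj (v w : L) :
  v != 0 -> w != 0 -> f_fun v^-1 = f_fun w^-1 -> v = w.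
Proof.
move=> v0 w0 fvw.
(* The inverse map sends f(u^-1) and its conjugates to u times [s u]; the squared norm appears
   because [inv_conic] is quadratic. *)
pose s u := e * triangle A B C u (phi u) (phi (phi u)) / norm u ^+ 2.
have phi_s (u : L) : phi (s u) = s u.
  rewrite /s fmorph_div rmorphXn phi_norm rmorphM phi_triangle.
  by rewrite rmorphB rmorphM phiA phiB phiC.
have s0 (u : L) : u != 0 -> s u != 0.
  move=> u0; rewrite mulf_neq0 ?invr_eq0 ?expf_neq0 ?norm_neq0 //.
  by rewrite mulf_neq0 ?e_neq0 ?triangle_neq0.
have sE (u : L) : u != 0 ->
    u * s u = let k := f_fun u^-1 in inv_conic A B C k (phi k) (phi (phi k)).
  move=> u0 /=; have nu0 := norm_neq0 u0.
  apply: (mulfI (expf_neq0 2 nu0)); rewrite -inv_conic_homog.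
  have conicE : conicL u = norm u * f_fun u^-1 by rewrite f_fun_conic // mulrC.
  have phiE y : norm u * phi y = phi (norm u * y) by rewrite rmorphM phi_norm.
  rewrite !phiE -conicE !phi_conic !phi3 inv_conicK //.
  by rewrite /s mulrCA [in X in _ * X]mulrC divfK ?expf_neq0.
have vw : w = s v / s w * v.
  by rewrite mulrAC [s v * v]mulrC sE // fvw -sE // mulfK ?s0.
set l := s v / s w in vw; have phi_l : phi l = l by rewrite fmorph_div !phi_s.
have l0 : l != 0 by rewrite mulf_neq0 ?invr_eq0 ?s0.
have fv0 : f_fun v^-1 != 0.
  by have := conicL_neq0 v0; rewrite f_fun_conic // mulf_eq0 => /norP[].
(* Scaling v by l multiplies the conic by l^2 and the norm by l^3, so equal values of f force l =
   1. *)
clearbody l; have := f_fun_conic w0.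
rewrite -fvw vw !rmorphM !phi_l conic_homog f_fun_conic //.
move=> h; suff -> : l = 1 by rewrite mul1r.
apply: (mulfI (mulf_neq0 (expf_neq0 2 l0) (mulf_neq0 fv0 (norm_neq0 v0)))).
by rewrite mulr1 [RHS]h; ring.
Qed.

Lemma f_fun_inj : injective f_fun.
Proof.
have f0 : f_fun 0 = 0 by rewrite /f_fun !rmorph0 !(mulr0, mul0r, addr0).
have f_neq0 (x : L) : x != 0 -> f_fun x != 0.
  move=> x0; have v0 : x^-1 != 0 by rewrite invr_eq0.
  have := conicL_neq0 v0; rewrite f_fun_conic // invrK mulf_eq0.
  by case/norP.
move=> x y; have [->|x0] := eqVneq x 0; have [->|y0] := eqVneq y 0 => //.
- by rewrite f0 => /esym/eqP; rewrite (negPf (f_neq0 _ y0)).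
- by rewrite f0 => /eqP; rewrite (negPf (f_neq0 _ x0)).
rewrite -[x]invrK -[y]invrK => fxy; congr _^-1.
by apply: f_funV_inj fxy; rewrite invr_eq0.
Qed.

End CubicAutomorphism.

(** * The map x -> x^(p^k) as a ring morphism *)

Definition frobenius_iter (R : comNzRingType) (p k : nat) of p \in [pchar R] :=
  fun x : R => x ^+ (p ^ k).

Section FrobeniusIter.

Variables (R : comNzRingType) (p k : nat) (pcharR : p \in [pchar R]).

Lemma frobenius_iter_is_nmod_morphism : nmod_morphism (frobenius_iter k pcharR).
Proof.
have p_nat : [pchar R].-nat (p ^ k)%N.
  by rewrite pnatX pnatE ?pcharR ?orTb // (pcharf_prime pcharR).
split=> [|x y]; last by rewrite /frobenius_iter exprDn_pchar.
rewrite /frobenius_iter expr0n expn_eq0 eqn0Ngt.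
by rewrite prime_gt0 ?(pcharf_prime pcharR).
Qed.

Lemma frobenius_iter_is_monoid_morphism :
  monoid_morphism (frobenius_iter k pcharR).
Proof.
by split=> [|x y]; rewrite /frobenius_iter ?expr1n ?exprMn.
Qed.

HB.instance Definition _ :=
  GRing.isNmodMorphism.Build R R (frobenius_iter k pcharR)
    frobenius_iter_is_nmod_morphism.

HB.instance Definition _ :=
  GRing.isMonoidMorphism.Build R R (frobenius_iter k pcharR)
    frobenius_iter_is_monoid_morphism.

End FrobeniusIter.

(* F is the field with q elements, L the field with q^3 elements, and
   iota : F -> L the inclusion. *)
Theorem theorem3p7 (p k q : nat) (p_prime : prime p) (p_odd : odd p)
  (k_gt0 : (0 < k)%N) (q_def : q = (p ^ k)%N)
  (F L : finFieldType) (cardF : #|F| = q) (cardL : #|L| = (q ^ 3)%N)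
  (iota : {rmorphism F -> L}) (A B C : F)
  (hC : C != 0)
  (h1 : A + B + 1 != 0)
  (h2 : A ^+ 3 + A * B + 1 != 0)
  (h3 : A ^+ 2 - A * B - A + B ^+ 2 - B + 1 != 0)
  (h4 : A ^+ 3 - A * B * C + A * B + C ^+ 2 - C + 1 = 0)
  (hm : forall t : L, t \in mu L (q ^ 2 + q + 1) ->
          ~~ root (map_poly iota (m_poly A B C)) t) :
  permutation_poly (f_poly q (iota A) (iota B) (iota C)).
Proof.
have pcharL : p \in [pchar L].
  by apply: (@card_finPcharP _ _ (k * 3)); rewrite // cardL q_def expnM.
pose phi : {rmorphism L -> L} := frobenius_iter k pcharL.
have phiE x : phi x = x ^+ q by rewrite q_def.
have phi2E x : phi (phi x) = x ^+ (q ^ 2) by rewrite !phiE -exprM mulnn.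
have phi3 x : phi (phi (phi x)) = x.
  by rewrite phi2E phiE -exprM -expnS -cardL expf_card.
have phi_iota a : phi (iota a) = iota a.
  by rewrite phiE -rmorphXn -cardF expf_card.
have rel : iota A ^+ 3 - iota A * iota B * iota C + iota A * iota B
    + iota C ^+ 2 - iota C + 1 = 0.
  by rewrite -[RHS](rmorph0 iota) -h4 !(rmorphD, rmorphB, rmorphN, rmorphM,
       rmorphXn, rmorph1).
(* The norm of t is t^(q^2+q+1), so norm 1 means membership in [mu]. *)
have m_norm1 t : t * phi t * phi (phi t) = 1 ->
    (m_poly (iota A) (iota B) (iota C)).[t] != 0.
  move=> nt; have := hm t; rewrite inE !exprD expr1.
  rewrite -phiE -phi2E mulrC mulrA mulrAC nt => /(_ (eqxx _)).
  rewrite /root; congr (_.[t] != 0); rewrite /m_poly.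
  rewrite !(rmorphD, rmorphB, rmorphN, rmorphM, rmorphXn) /=.
  by rewrite !map_polyC map_polyX.
have q_gt0 : (0 < q)%N by rewrite q_def expn_gt0 prime_gt0.
have fE x : (f_poly q (iota A) (iota B) (iota C)).[x] =
    f_fun phi (iota A) (iota B) (iota C) x.
  rewrite /f_poly !(hornerD, hornerM, hornerC, hornerXn, hornerX).
  rewrite /f_fun !phi2E !phiE.
  (* At 0 both sides vanish, all exponents being positive. *)
  have [->|x0] := eqVneq x 0.
    have q2_gt1 : (1 < q ^ 2 + q)%N by rewrite -addn1 leq_add ?expn_gt0 ?q_gt0.
    rewrite !expr0n addn1 !gtn_eqF ?subn_gt0 ?expn_gt0 ?q_gt0 //.
    by rewrite !(mulr0, mul0r).
  have -> : x ^+ (q ^ 2 + q - 1) = x ^+ (q ^ 2) * x ^+ q / x.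
    apply: (canRL (mulfK x0)); rewrite -exprSr subn1 prednK ?exprD //.
    by rewrite addn_gt0 q_gt0 orbT.
  have -> : x ^+ (q ^ 2 - q + 1) = x ^+ (q ^ 2) * x / x ^+ q.
    apply: (canRL (mulfK (expf_neq0 q x0))).
    by rewrite -exprD addnAC subnK ?exprD ?expr1 // -{1}[q]expn1 leq_pexp2l.
  by [].
apply: injF_bij => x y; rewrite !fE.
exact: (f_fun_inj phi3 (phi_iota A) (phi_iota B) (phi_iota C) rel m_norm1).
Qed.
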